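(* Let $n\geq 2$ be an integer, let $p$ be a prime number with $\gcd(n,p)=1$, let $\alpha\geq 1$ be an integer, and let $m=np^{\alpha}$. (1) If $n$ is square-free, then for every exponential divisor $d_e$ of $m$ one has $H(d_e)\geq H(m)$. (2) If $n$ is not square-free, then for every exponential divisor $d_e$ of $m$ of the form $d_e=np^{\beta}$, one has $H(d_e)\leq H(m)$ whenever $\beta\leq\alpha\leq\Omega(n)e^{-H(n)}$.
   Context: $\log$ is the natural logarithm. For an integer $N=p_1^{\alpha_1}\cdots p_r^{\alpha_r}\geq 2$ (distinct primes $p_i$, exponents $\alpha_i\geq 1$), $\Omega(N)=\alpha_1+\dots+\alpha_r$ and the entropy of $N$ is $$H(N)=-\sum_{i=1}^r\frac{\alpha_i}{\Omega(N)}\log\frac{\alpha_i}{\Omega(N)}.$$ An exponential divisor of $N$ is an integer $d=p_1^{\beta_1}\cdots p_r^{\beta_r}$ with all $\beta_i\geq 1$ and $\beta_i\mid\alpha_i$ for every $i\in\{1,\dots,r\}$. *)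

(* Defs.v *)
From mathcomp Require Import all_boot all_order all_algebra.
From mathcomp Require Import all_reals sequences exp.

Set Implicit Arguments.
Unset Strict Implicit.
Unset Printing Implicit Defensive.

Import Order.TTheory GRing.Theory Num.Theory.

Definition squarefree (n : nat) : Prop := forall d : nat, d ^ 2 %| n -> d = 1.

Definition Omega (N : nat) : nat := \sum_(p <- primes N) logn p N.

(* [primes N] lists each prime divisor p_i of N once, and [logn p_i N] is its
   exponent alpha_i; for N <= 1 the value is the junk value 0. *)
Definition entropy (R : realType) (N : nat) : R :=
  (- \sum_(p <- primes N)
       ((logn p N)%:R / (Omega N)%:R) * ln ((logn p N)%:R / (Omega N)%:R))%R.

(* Meaningful for N >= 2; [b p] plays the role of the exponent beta_i at p = p_i. *)
Definition exp_divisor (d N : nat) : Prop :=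
  exists b : nat -> nat,
    (forall p, p \in primes N -> (0 < b p) /\ (b p %| logn p N)) /\
    d = \prod_(p <- primes N) p ^ b p.

(* Main.v *)
Require Import Defs.
From mathcomp Require Import all_boot all_order all_algebra.
From mathcomp Require Import all_reals sequences exp.
From mathcomp Require Import ring lra.

(** Writing [A = Omega n] and [S = \sum_i alpha_i ln alpha_i] for [n], one has
    [H(n p^k) = ln (A + k) - (S + k ln k) / (A + k)], a function of [k] whose
    derivative has the sign of [S - A ln k]. If [n] is square-free then [S = 0]
    and the function decreases on [k >= 1]; in general it increases as long as
    [ln k <= S / A], that is [k <= A e^(-H(n))]. The monotonicity is obtained
    without derivatives, from the concavity of [ln]. *)

Import Order.TTheory GRing.Theory Num.Theory.

Definition sum_xlnx (R : realType) (N : nat) : R :=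
  (\sum_(q <- primes N) (logn q N)%:R * ln (logn q N)%:R)%R.

Definition extended_entropy {R : realType} (A S x : R) : R :=
  (ln (A + x) - (S + x * ln x) / (A + x))%R.

Section RealInequalities.
Local Open Scope ring_scope.
Variable R : realType.
Implicit Types A S x y : R.

Lemma ln_le_subr1 x : 0 < x -> ln x <= x - 1.
Proof.
by move=> x0; have := @le_ln1Dx R (x - 1); rewrite addrCA subrr addr0; apply; lra.
Qed.

(** Two-term log-sum inequality: concavity of [ln] at the points [x / y] and [1] with weights [y]
    and [A]. It replaces differentiation in the comparison below. *)
Lemma ln_log_sum A x y : 0 < A -> 0 < x -> 0 < y ->
  y * (ln x - ln y) <= (A + y) * (ln (A + x) - ln (A + y)).
Proof.
move=> A0 x0 y0.
have Ax0 : 0 < A + x by lra.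
have Ay0 : 0 < A + y by lra.
have T0 : 0 < (A + y) / (A + x) by rewrite divr_gt0.
have xy0 : 0 < x / y by rewrite divr_gt0.
have E : ln ((A + y) / (A + x)) = ln (A + y) - ln (A + x) by rewrite ln_div ?posrE.
have E2 : ln (x / y * ((A + y) / (A + x)))
    = ln x - ln y + (ln (A + y) - ln (A + x)).
  by rewrite lnM ?posrE // E ln_div ?posrE.
(* The bound [ln t <= t - 1] is taken at [T = (A + y) / (A + x)] with weight [A] and at [x / y * T]
   with weight [y]; this [T] makes the weighted right-hand sides cancel. *)
have := ler_wpM2l (ltW A0) (ln_le_subr1 _ T0).
have := ler_wpM2l (ltW y0) (ln_le_subr1 _ (mulr_gt0 xy0 T0)).
rewrite E E2.
have : y * (x / y * ((A + y) / (A + x)) - 1) + A * ((A + y) / (A + x) - 1) = 0.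
  by field; rewrite !gt_eqF.
lra.
Qed.

(* The hypothesis says that the derivative at [x] does not point away from [x]
   as seen from [y]; it covers both the increasing and the decreasing case. *)
Lemma extended_entropy_le A S x y : 0 < A -> 0 < x -> 0 < y ->
  0 <= (S - A * ln x) * (x - y) ->
  extended_entropy A S y <= extended_entropy A S x.
Proof.
move=> A0 x0 y0 h; rewrite /extended_entropy -subr_ge0.
have Ax0 : 0 < A + x by lra.
have Ay0 : 0 < A + y by lra.
(* The difference splits into the term signed by the hypothesis and the gap in [ln_log_sum]. *)
have -> : ln (A + x) - (S + x * ln x) / (A + x)
          - (ln (A + y) - (S + y * ln y) / (A + y))
  = (S - A * ln x) * (x - y) / ((A + x) * (A + y))
    + ((A + y) * (ln (A + x) - ln (A + y)) - y * (ln x - ln y)) / (A + y).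
  by field; rewrite !gt_eqF.
have := ln_log_sum _ _ _ A0 x0 y0; rewrite -subr_ge0 => h2.
by rewrite addr_ge0 // divr_ge0 // ltW // mulr_gt0.
Qed.

End RealInequalities.

Lemma Omega_gt0 N : 1 < N -> 0 < Omega N.
Proof.
move=> N1; have pN : pdiv N \in primes N.
  by rewrite mem_primes pdiv_prime // (ltnW N1) pdiv_dvd.
rewrite /Omega (big_rem _ pN) /= addn_gt0 logn_gt0 pN //.
Qed.

Lemma entropyE (R : realType) N : 1 < N ->
  entropy R N = (ln (Omega N)%:R - sum_xlnx R N / (Omega N)%:R)%R.
Proof.
move=> N1; have O0 : (0 < (Omega N)%:R :> R)%R by rewrite ltr0n Omega_gt0.
have eqT : (\sum_(q <- primes N) (logn q N)%:R = (Omega N)%:R :> R)%R.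
  by rewrite /Omega natr_sum.
(* The weights sum to 1, so [ln (Omega N)] spreads over the primes and the two sides compare
   termwise. *)
have -> : (ln (Omega N)%:R
    = (\sum_(q <- primes N) (logn q N)%:R) / (Omega N)%:R * ln (Omega N)%:R :> R)%R.
  by rewrite eqT divff ?mul1r // gt_eqF.
rewrite /entropy /sum_xlnx !mulr_suml -sumrB -sumrN.
rewrite big_seq_cond [RHS]big_seq_cond; apply: eq_bigr => q.
rewrite andbT -logn_gt0 => q0.
rewrite ln_div ?posrE ?ltr0n ?Omega_gt0 //; ring.
Qed.

Section CoprimePrimePower.
Variables n p : nat.
Hypotheses (n_gt0 : 0 < n) (p_prime : prime p) (co_np : coprime n p).

Lemma coprime_notin_primes : p \notin primes n.
Proof. by rewrite mem_primes p_prime n_gt0 -prime_coprime // coprime_sym. Qed.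

Lemma primes_mul_exp k : 0 < k -> perm_eq (primes (n * p ^ k)) (p :: primes n).
Proof.
move=> k0; apply: uniq_perm; rewrite ?primes_uniq //= ?primes_uniq
  ?coprime_notin_primes // => q.
by rewrite primesM ?expn_gt0 ?(prime_gt0 p_prime) //
  primesX // (primes_prime p_prime) !inE orbC.
Qed.

(** [F] takes the prime and its exponent separately, so that this one splitting serves both [Omega]
    and [sum_xlnx]. *)
Lemma big_primes_mul_exp (T : Type) (idx : T) (op : Monoid.com_law idx)
    (F : nat -> nat -> T) k : 0 < k ->
  \big[op/idx]_(q <- primes (n * p ^ k)) F q (logn q (n * p ^ k)) =
  op (F p k) (\big[op/idx]_(q <- primes n) F q (logn q n)).
Proof.
move=> k0; rewrite (perm_big _ (primes_mul_exp _ k0)) big_cons.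
have pk0 : 0 < p ^ k by rewrite expn_gt0 prime_gt0.
have logp : logn p n = 0.
  by apply/eqP; rewrite -leqn0 leqNgt logn_gt0 coprime_notin_primes.
rewrite lognM // logp pfactorK // add0n; congr (op _ _).
rewrite big_seq [RHS]big_seq; apply: eq_bigr => q qn.
rewrite lognM // lognX (logn_prime _ p_prime); case: (eqVneq q p) => [qp|_].
  by move: qn; rewrite qp (negbTE coprime_notin_primes).
by rewrite muln0 addn0.
Qed.

Lemma Omega_mul_exp k : 0 < k -> Omega (n * p ^ k) = Omega n + k.
Proof.
by move=> k0; rewrite /Omega (big_primes_mul_exp _ _ _ (fun _ a => a)) // addnC.
Qed.

Lemma entropy_mul_exp (R : realType) k : 0 < k ->
  entropy R (n * p ^ k) = extended_entropy (Omega n)%:R (sum_xlnx R n) k%:R.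
Proof.
move=> k0; rewrite entropyE; last first.
  rewrite (leq_trans _ (leq_pmull _ n_gt0)) //.
  by rewrite -(expn0 p) ltn_exp2l // prime_gt1.
rewrite /extended_entropy Omega_mul_exp // natrD; congr (_ - _ / _)%R.
by rewrite /sum_xlnx (big_primes_mul_exp _ _ _ (fun _ a => a%:R * ln a%:R)%R) //= addrC.
Qed.

Lemma exp_divisor_mul_exp d k : 0 < k -> exp_divisor d (n * p ^ k) ->
  exists2 b, 0 < b <= k & exists2 e, exp_divisor e n & d = e * p ^ b.
Proof.
move=> k0 [b [hb ->]].
have mem := perm_mem (primes_mul_exp _ k0).
have logE q : logn q (n * p ^ k) = logn q n + k * (q == p).
  by rewrite lognM ?expn_gt0 ?(prime_gt0 p_prime) // lognX (logn_prime _ p_prime) eq_sym.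
have logp : logn p n = 0.
  by apply/eqP; rewrite -leqn0 leqNgt logn_gt0 coprime_notin_primes.
exists (b p).
  have [|-> /dvdn_leq] := hb p; first by rewrite mem mem_head.
  by rewrite logE logp eqxx muln1; apply.
exists (\prod_(q <- primes n) q ^ b q); last first.
  by rewrite (perm_big _ (primes_mul_exp _ k0)) big_cons mulnC.
exists b; split=> // q qn; have [|b0] := hb q; first by rewrite mem inE qn orbT.
rewrite logE; case: (eqVneq q p) => [qp|_]; last by rewrite muln0 addn0.
by move: qn; rewrite qp (negbTE coprime_notin_primes).
Qed.

End CoprimePrimePower.

Lemma squarefree_logn n q : squarefree n -> q \in primes n -> logn q n = 1.
Proof.
move=> sq qn; have := qn; rewrite mem_primes => /and3P[q_pr n0 _].
apply/eqP; rewrite eqn_leq logn_gt0 qn andbT leqNgt; apply/negP.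
rewrite -pfactor_dvdn // => /sq q1; by rewrite q1 in q_pr.
Qed.

(** Every exponent of [n] is 1, whose only divisor is 1. *)
Lemma squarefree_exp_divisor n d : 0 < n -> squarefree n -> exp_divisor d n -> d = n.
Proof.
move=> n0 sq [b [hb ->]]; rewrite [RHS](prod_prime_decomp n0).
rewrite prime_decompE big_map /= !(big_seq _ _ (primes n)).
apply: eq_bigr => q qn; have [_] := hb q qn.
by rewrite squarefree_logn // dvdn1 => /eqP->.
Qed.

Lemma squarefree_sum_xlnx (R : realType) n : squarefree n -> sum_xlnx R n = 0%R.
Proof.
move=> sq; rewrite /sum_xlnx big_seq big1 // => q qn.
by rewrite squarefree_logn // ln1 mulr0.
Qed.

Theorem mainTheorem8 (R : realType) (n p alpha : nat) (hn : (2 <= n)%N)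
  (hp : prime p) (hnp : gcdn n p = 1%N) (halpha : (1 <= alpha)%N) :
  (squarefree n ->
   forall d : nat, exp_divisor d (n * p ^ alpha)%N ->
   (entropy R d >= entropy R (n * p ^ alpha)%N)%R) /\
  (~ squarefree n ->
   forall d beta : nat, exp_divisor d (n * p ^ alpha)%N ->
   d = (n * p ^ beta)%N ->
   (beta <= alpha)%N ->
   (alpha%:R <= (Omega n)%:R * expR (- entropy R n))%R ->
   (entropy R d <= entropy R (n * p ^ alpha)%N)%R).
Proof.
have n0 : 0 < n by apply: ltnW.
have co : coprime n p by apply/eqP.
have A0 : (0 < (Omega n)%:R :> R)%R by rewrite ltr0n Omega_gt0.
split=> [sq d|_ d b].
  case/(exp_divisor_mul_exp n p n0 hp co d alpha halpha) => b /andP[b0 ba] [e].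
  move=> /(squarefree_exp_divisor _ _ n0 sq)-> ->.
  (* Here [x = b] and [y = alpha]; with [S = 0] the condition reads
     [0 <= A * ln b * (alpha - b)]. *)
  rewrite !entropy_mul_exp //; apply: extended_entropy_le; rewrite ?ltr0n ?Omega_gt0 //.
  rewrite squarefree_sum_xlnx // sub0r -mulrNN opprK mulr_ge0 //.
    by rewrite mulr_ge0 ?ln_ge0 ?ler1n ?ltW.
  by rewrite opprB subr_ge0 ler_nat.
case/(exp_divisor_mul_exp n p n0 hp co d alpha halpha) => b' /andP[b'0 _] [e _ dE'].
move=> dE ba ha.
(* If [b = 0] then [d = n]; but [p] divides any exponential divisor of [n * p ^ alpha],
   contradicting coprimality. *)
have b0 : 0 < b.
  rewrite lt0n; apply/eqP => bE; move: co; rewrite coprime_sym prime_coprime //.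
  have -> : p %| n by rewrite -[n]muln1 -(expn0 p) -bE -dE dE' dvdn_mull // dvdn_exp.
  by [].
rewrite dE !entropy_mul_exp //; apply: extended_entropy_le; rewrite ?ltr0n ?Omega_gt0 //.
apply: mulr_ge0; last by rewrite subr_ge0 ler_nat.
have a0 : (0 < alpha%:R :> R)%R by rewrite ltr0n.
(* Taking logarithms turns the bound on [alpha] into [ln alpha <= ln A - H(n) = S / A]. *)
move: ha; rewrite -ler_ln ?posrE ?mulr_gt0 ?expR_gt0 // lnM ?posrE ?expR_gt0 //.
rewrite expRK entropyE // opprB addrCA subrr addr0 ler_pdivlMr // mulrC.
by rewrite subr_ge0.
Qed.
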